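(* Let $X=(\mathbb{C}^n,\|\cdot\|)$ be an $n$-dimensional complex CL-space with an absolute norm. Then $(a_1,\dots,a_n)\in X$ is a complex extreme point of $B_X$ if and only if $(|a_1|,\dots,|a_n|)$ is a convex combination of extreme points of $B_X$ all of whose coordinates are nonnegative real numbers. In short, $\mathbb{R}_+^n\cap\mathrm{ext}_{\mathbb{C}}B_X=\mathrm{co}(\mathbb{R}_+^n\cap\mathrm{ext}\,B_X)$.
   Context: A norm on $\mathbb{C}^n$ is absolute if $\|(a_1,\dots,a_n)\|=\|(|a_1|,\dots,|a_n|)\|$ for all scalars and $\|e_j\|=1$ for the canonical basis vectors. A Banach space is a CL-space if its unit ball is the absolutely convex hull of every maximal convex subset of its unit sphere; in finite dimensions, equivalently, $|x^*(x)|=1$ for every extreme point $x^*$ of $B_{X^*}$ and every extreme point $x$ of $B_X$. $\mathrm{ext}\,B_X$ is the set of extreme points of $B_X$ ($x\in B_X$ with $y+z=2x$, $y,z\in B_X$ implying $x=y=z$). $x\in B_X$ is a complex extreme point of $B_X$ if $\sup_{0\le\theta\le2\pi}\|x+e^{i\theta}y\|\le1$ for some $y\in X$ implies $y=0$; $\mathrm{ext}_{\mathbb{C}}B_X$ is the set of complex extreme points. $\mathbb{R}_+^n$ denotes vectors with nonnegative real coordinates and $\mathrm{co}$ the convex hull. *)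

(* Defs.v *)
From Stdlib Require Import Reals List.
From Stdlib Require Fin.
Open Scope R_scope.

Definition C := (R * R)%type.
Definition C0 : C := (0, 0).
Definition C1 : C := (1, 0).
Definition RtoC (t : R) : C := (t, 0).
Definition Cadd (z w : C) : C := (fst z + fst w, snd z + snd w).
Definition Cmul (z w : C) : C :=
  (fst z * fst w - snd z * snd w, fst z * snd w + snd z * fst w).
Definition Cmod (z : C) : R := sqrt (fst z ^ 2 + snd z ^ 2).
Definition Cexpi (theta : R) : C := (cos theta, sin theta).

Definition vec (n : nat) := Fin.t n -> C.
Definition vzero {n} : vec n := fun _ => C0.
Definition vadd {n} (x y : vec n) : vec n := fun i => Cadd (x i) (y i).
Definition vscale {n} (c : C) (x : vec n) : vec n := fun i => Cmul c (x i).
Definition vabs {n} (x : vec n) : vec n := fun i => RtoC (Cmod (x i)).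
Definition unitvec {n} (j : Fin.t n) : vec n :=
  fun i => if Fin.eq_dec i j then C1 else C0.
Definition nonneg_vec {n} (x : vec n) : Prop :=
  forall i, 0 <= fst (x i) /\ snd (x i) = 0.

Definition is_norm {n} (N : vec n -> R) : Prop :=
  (forall x, N x = 0 -> x = vzero) /\
  (forall (c : C) x, N (vscale c x) = Cmod c * N x) /\
  (forall x y, N (vadd x y) <= N x + N y).

Definition absolute_norm {n} (N : vec n -> R) : Prop :=
  (forall x, N x = N (vabs x)) /\ (forall j : Fin.t n, N (unitvec j) = 1).

Definition in_ball {n} (N : vec n -> R) (x : vec n) : Prop := N x <= 1.
Definition in_sphere {n} (N : vec n -> R) (x : vec n) : Prop := N x = 1.

Definition convex_set {n} (F : vec n -> Prop) : Prop :=
  forall x y t, F x -> F y -> 0 <= t <= 1 ->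
    F (vadd (vscale (RtoC t) x) (vscale (RtoC (1 - t)) y)).

Definition max_convex_sphere {n} (N : vec n -> R) (F : vec n -> Prop) : Prop :=
  convex_set F /\ (forall x, F x -> in_sphere N x) /\
  (forall G : vec n -> Prop, convex_set G -> (forall x, G x -> in_sphere N x) ->
     (forall x, F x -> G x) -> forall x, G x -> F x).

Definition lincomb {n} (l : list (C * vec n)) : vec n :=
  fold_right (fun p acc => vadd (vscale (fst p) (snd p)) acc) vzero l.

Definition in_aco {n} (F : vec n -> Prop) (x : vec n) : Prop :=
  exists l : list (C * vec n),
    Forall (fun p => F (snd p)) l /\
    fold_right (fun p s => Cmod (fst p) + s) 0 l <= 1 /\
    x = lincomb l.

Definition in_co {n} (A : vec n -> Prop) (x : vec n) : Prop :=
  exists l : list (R * vec n),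
    Forall (fun p => 0 <= fst p /\ A (snd p)) l /\
    fold_right (fun p s => fst p + s) 0 l = 1 /\
    x = lincomb (map (fun p => (RtoC (fst p), snd p)) l).

Definition CL_space {n} (N : vec n -> R) : Prop :=
  forall F, max_convex_sphere N F -> forall x, in_ball N x <-> in_aco F x.

Definition ext_point {n} (N : vec n -> R) (x : vec n) : Prop :=
  in_ball N x /\
  forall y z, in_ball N y -> in_ball N z ->
    vadd y z = vscale (RtoC 2) x -> x = y /\ x = z.

(** Complex extreme points of B_X (sup over theta <= 1 written pointwise). *)
Definition complex_ext_point {n} (N : vec n -> R) (x : vec n) : Prop :=
  in_ball N x /\
  forall y, (forall theta, 0 <= theta <= 2 * PI ->
               N (vadd x (vscale (Cexpi theta) y)) <= 1) -> y = vzero.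

(* Main.v *)
From Stdlib Require Import Reals List Lra Classical FunctionalExtensionality.
From mathcomp Require classical_sets.
Require Import Defs.
Open Scope R_scope.

(** By Minkowski's theorem a point [a] of the ball is a convex combination of extreme points
    [z_k], so [|a|] is dominated by [y = sum t_k |z_k|], and the [|z_k|] are again extreme.
    An absolute norm is monotone, hence [N (a + e^(i theta) (y - |a|)) <= N y <= 1] for all
    [theta], and complex extremality forces [|a| = y].

    Conversely, fix a coordinate [j] and a maximal convex subset [F] of the sphere through
    [e_j]. By Hahn-Banach some norm-one functional equals 1 on [F]; since the ball is the
    absolutely convex hull of [F], every extreme point lies in a rotation of [F]. Rotating the
    coefficients of the functional makes them nonnegative, and it then takes the value 1 on all
    nonnegative extreme points, hence at [|a|]. If [N (a + e^(i theta) y) <= 1] for all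
    [theta], averaging [|a + e^(i theta) y|] over four angles gives a vector at least [|a|],
    strictly larger in coordinate [j] unless [y_j = 0], on which the functional is still at
    most 1. *)

Ltac vec_ring :=
  intros; apply functional_extensionality; intro;
  unfold vadd, vscale, vzero, Cadd, Cmul, RtoC, C0, C1; simpl;
  apply injective_projections; simpl; ring.

Notation rscale t x := (vscale (RtoC t) x).

(** * Coordinates *)

(** The diagonal operator with entries [d]. For unimodular [d] it is an isometry of any absolute
    norm, so each coordinate can be rotated on its own. *)
Definition vmul {n} (d x : vec n) : vec n := fun i => Cmul (d i) (x i).

Lemma vmul_vadd {n} (d x y : vec n) : vmul d (vadd x y) = vadd (vmul d x) (vmul d y).
Proof. unfold vmul; vec_ring. Qed.

Lemma vmul_vscale {n} (d x : vec n) c : vmul d (vscale c x) = vscale c (vmul d x).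
Proof. unfold vmul; vec_ring. Qed.

Lemma Cmod_ge0 z : 0 <= Cmod z.
Proof. apply sqrt_pos. Qed.

Lemma Cmod_sqr z : Cmod z ^ 2 = fst z ^ 2 + snd z ^ 2.
Proof. unfold Cmod. rewrite pow2_sqrt; [reflexivity | nra]. Qed.

Lemma Cmod_eq r z : 0 <= r -> r ^ 2 = fst z ^ 2 + snd z ^ 2 -> Cmod z = r.
Proof. intros Hr H. unfold Cmod. rewrite <- H. now apply sqrt_pow2. Qed.

Lemma Cmod_le r z : 0 <= r -> fst z ^ 2 + snd z ^ 2 <= r ^ 2 -> Cmod z <= r.
Proof.
  intros Hr H. pose proof (Cmod_ge0 z). pose proof (Cmod_sqr z). nra.
Qed.

Lemma Cmod_RtoC t : 0 <= t -> Cmod (RtoC t) = t.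
Proof. intro Ht. apply Cmod_eq; simpl; [assumption | ring]. Qed.

Lemma Cmod_mul z w : Cmod (Cmul z w) = Cmod z * Cmod w.
Proof.
  pose proof (Cmod_ge0 z); pose proof (Cmod_ge0 w).
  apply Cmod_eq; [nra |].
  rewrite Rpow_mult_distr, !Cmod_sqr. simpl. ring.
Qed.

Lemma Cmod_triangle z w : Cmod (Cadd z w) <= Cmod z + Cmod w.
Proof.
  pose proof (Cmod_ge0 z); pose proof (Cmod_ge0 w).
  apply Cmod_le; [lra |].
  replace ((Cmod z + Cmod w) ^ 2) with (Cmod z ^ 2 + Cmod w ^ 2 + 2 * (Cmod z * Cmod w)) by ring.
  rewrite <- Cmod_mul with (z := z), !Cmod_sqr. simpl.
  (* Cauchy-Schwarz in the plane by Lagrange's identity: [Cmod (Cmul z w) ^ 2] is the squared inner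
     product plus the squared determinant. *)
  assert (fst z * fst w + snd z * snd w <= Cmod (Cmul z w)).
  { pose proof (Cmod_sqr (Cmul z w)) as E. pose proof (Cmod_ge0 (Cmul z w)).
    simpl in E. pose proof (Rle_0_sqr (fst z * snd w - snd z * fst w)). unfold Rsqr in *.
    nra. }
  lra.
Qed.

Lemma Cmod_opposite_sum a v :
  2 * Cmod a <= Cmod (Cadd a v) + Cmod (Cadd a (Cmul (-1, 0) v)).
Proof.
  pose proof (Cmod_triangle (Cadd a v) (Cadd a (Cmul (-1, 0) v))) as E.
  replace (Cadd (Cadd a v) (Cadd a (Cmul (-1, 0) v))) with (Cmul (RtoC 2) a) in E
    by (apply injective_projections; simpl; ring).
  rewrite Cmod_mul, Cmod_RtoC in E; lra.
Qed.

Lemma Cmod_eq0 z : Cmod z = 0 -> z = C0.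
Proof.
  intro H. pose proof (Cmod_sqr z) as E. rewrite H in E.
  apply injective_projections; simpl; nra.
Qed.

Lemma Cmod_C0 : Cmod C0 = 0.
Proof. apply Cmod_eq; simpl; lra. Qed.

Lemma Cmod_C1 : Cmod C1 = 1.
Proof. apply Cmod_eq; simpl; lra. Qed.

Lemma Cmod_Cexpi t : Cmod (Cexpi t) = 1.
Proof.
  apply Cmod_eq; [lra |]. simpl. pose proof (sin2_cos2 t) as E. unfold Rsqr in E. lra.
Qed.

Fixpoint fin_enum n : list (Fin.t n) :=
  match n with
  | O => nil
  | S n => Fin.F1 :: map Fin.FS (fin_enum n)
  end.

Lemma fin_enum_complete n (i : Fin.t n) : In i (fin_enum n).
Proof.
  induction i as [n | n i IH]; simpl; [now left |]. right. now apply in_map.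
Qed.

(** A vector is the sum of its coordinate vectors; this induction principle stands in for explicit
    finite sums. *)
Lemma coord_ind {n} (P : vec n -> Prop) (x : vec n) :
  P vzero -> (forall y z, P y -> P z -> P (vadd y z)) ->
  (forall i, P (vscale (x i) (unitvec i))) -> P x.
Proof.
  intros P0 PD Pi.
  (* Induction on a list of coordinates, for [x] truncated to that list; a repeated entry leaves the
     truncation unchanged. *)
  assert (H : forall l, P (fun i => if in_dec Fin.eq_dec i l then x i else C0)).
  { induction l as [| a l IH]; [exact P0 |].
    destruct (in_dec Fin.eq_dec a l) as [Ha | Ha].
    - match goal with H : P ?v |- P ?w => replace w with v; [exact H |] end.
      apply functional_extensionality; intro i.
      destruct (in_dec Fin.eq_dec i l) as [Hi | Hi], (in_dec Fin.eq_dec i (a :: l)) as [Hj | Hj];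
        trivial; exfalso; simpl in Hj; [tauto |].
      destruct Hj; [subst; tauto | tauto].
    - match goal with H : P ?v |- P ?w =>
        replace w with (vadd (vscale (x a) (unitvec a)) v); [apply PD; [apply Pi | exact H] |] end.
      apply functional_extensionality; intro i. unfold vadd, vscale, unitvec.
      destruct (Fin.eq_dec i a) as [E | E]; [subst |];
        [destruct (in_dec Fin.eq_dec a l) as [Hi | Hi], (in_dec Fin.eq_dec a (a :: l)) as [Hj | Hj]
        |destruct (in_dec Fin.eq_dec i l) as [Hi | Hi], (in_dec Fin.eq_dec i (a :: l)) as [Hj | Hj]];
        simpl in Hj; try tauto;
        try (apply injective_projections; simpl; ring).
      destruct Hj; [congruence | tauto]. }
  specialize (H (fin_enum n)).
  match goal with H : P ?v |- P ?w => replace w with v; [exact H |] end.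
  apply functional_extensionality; intro i.
  destruct (in_dec Fin.eq_dec i (fin_enum n)) as [Hi | Hi]; [reflexivity |].
  destruct (Hi (fin_enum_complete n i)).
Qed.

(** * Absolute norms *)

Lemma norm_ge0 {n} (N : vec n -> R) x : is_norm N -> 0 <= N x.
Proof.
  intros (_ & HZ & HD).
  pose proof (HD x (rscale (-1) x)) as H.
  replace (vadd x (rscale (-1) x)) with (rscale 0 x) in H by vec_ring.
  rewrite !HZ, (Cmod_RtoC 0) in H by lra.
  rewrite (Cmod_eq 1 (RtoC (-1))) in H by (simpl; lra). lra.
Qed.

Lemma norm_rscale {n} (N : vec n -> R) t x : is_norm N -> 0 <= t -> N (rscale t x) = t * N x.
Proof. intros (_ & HZ & _) Ht. now rewrite HZ, Cmod_RtoC. Qed.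

Lemma norm_vzero {n} (N : vec n -> R) : is_norm N -> N vzero = 0.
Proof.
  intro HN. replace (@vzero n) with (rscale 0 (@vzero n)) by vec_ring.
  rewrite norm_rscale by (auto; lra). ring.
Qed.

Lemma norm_opp {n} (N : vec n -> R) x : is_norm N -> N (rscale (-1) x) = N x.
Proof.
  intros (_ & HZ & _). rewrite HZ, (Cmod_eq 1 (RtoC (-1))) by (simpl; lra). ring.
Qed.

Lemma norm_convex {n} (N : vec n -> R) s t x y :
  is_norm N -> 0 <= s -> 0 <= t -> N (vadd (rscale s x) (rscale t y)) <= s * N x + t * N y.
Proof.
  intros HN Hs Ht. rewrite <- !norm_rscale by assumption. apply HN.
Qed.

Lemma ball_convex {n} (N : vec n -> R) s t x y :
  is_norm N -> 0 <= s -> 0 <= t -> s + t = 1 -> N x <= 1 -> N y <= 1 ->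
  N (vadd (rscale s x) (rscale t y)) <= 1.
Proof.
  intros HN Hs Ht E Hx Hy. pose proof (norm_convex N s t x y HN Hs Ht). nra.
Qed.

Lemma norm_ext_Cmod {n} (N : vec n -> R) x y :
  absolute_norm N -> (forall i, Cmod (x i) = Cmod (y i)) -> N x = N y.
Proof.
  intros (HA & _) H. rewrite (HA x), (HA y). f_equal.
  apply functional_extensionality; intro i. unfold vabs. now rewrite H.
Qed.

Lemma norm_vmul {n} (N : vec n -> R) d x :
  absolute_norm N -> (forall i, Cmod (d i) = 1) -> N (vmul d x) = N x.
Proof.
  intros HA Hd. apply norm_ext_Cmod; [assumption |]. intro i. unfold vmul.
  rewrite Cmod_mul, Hd. ring.
Qed.

(* Shrinking one coordinate by [r] averages the vector with its reflection in that
   coordinate. *)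
Lemma norm_shrink_coord {n} (N : vec n -> R) (r : R) (j : Fin.t n) x :
  is_norm N -> absolute_norm N -> 0 <= r <= 1 ->
  N (fun i => if Fin.eq_dec i j then Cmul (RtoC r) (x i) else x i) <= N x.
Proof.
  intros HN HA Hr.
  set (x' := fun i => if Fin.eq_dec i j then Cmul (RtoC (-1)) (x i) else x i).
  assert (E : N x' = N x).
  { apply norm_ext_Cmod; [assumption |]. intro i. unfold x'.
    destruct (Fin.eq_dec i j); [| reflexivity].
    rewrite Cmod_mul, (Cmod_eq 1 (RtoC (-1))) by (simpl; lra). ring. }
  replace (fun i => if Fin.eq_dec i j then Cmul (RtoC r) (x i) else x i)
    with (vadd (rscale ((1 + r) / 2) x) (rscale ((1 - r) / 2) x')).
  - eapply Rle_trans; [apply norm_convex; [assumption | lra | lra] |].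
    rewrite E. lra.
  - apply functional_extensionality; intro i. unfold vadd, vscale, x'.
    destruct (Fin.eq_dec i j); apply injective_projections; simpl; field.
Qed.

Lemma norm_shrink {n} (N : vec n -> R) (r : Fin.t n -> R) x :
  is_norm N -> absolute_norm N -> (forall i, 0 <= r i <= 1) ->
  N (fun i => Cmul (RtoC (r i)) (x i)) <= N x.
Proof.
  intros HN HA Hr.
  assert (H : forall l, N (fun i => if in_dec Fin.eq_dec i l
                                    then Cmul (RtoC (r i)) (x i) else x i) <= N x).
  { induction l as [| a l IH]; [simpl; apply Rle_refl |].
    destruct (in_dec Fin.eq_dec a l) as [Ha | Ha].
    - eapply Rle_trans; [right | exact IH]. f_equal.
      apply functional_extensionality; intro i.
      destruct (in_dec Fin.eq_dec i l) as [Hi | Hi], (in_dec Fin.eq_dec i (a :: l)) as [Hj | Hj];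
        trivial; exfalso; simpl in Hj; [tauto |].
      destruct Hj; [subst; tauto | tauto].
    - eapply Rle_trans; [| exact IH].
      eapply Rle_trans; [right | apply (norm_shrink_coord N (r a) a); auto]. f_equal.
      apply functional_extensionality; intro i.
      destruct (Fin.eq_dec i a) as [E | E]; [subst |];
        [destruct (in_dec Fin.eq_dec a l) as [Hi | Hi], (in_dec Fin.eq_dec a (a :: l)) as [Hj | Hj]
        |destruct (in_dec Fin.eq_dec i l) as [Hi | Hi], (in_dec Fin.eq_dec i (a :: l)) as [Hj | Hj]];
        simpl in Hj; try tauto.
      destruct Hj; [congruence | tauto]. }
  eapply Rle_trans; [right | exact (H (fin_enum n))]. f_equal.
  apply functional_extensionality; intro i.
  destruct (in_dec Fin.eq_dec i (fin_enum n)) as [Hi | Hi]; [reflexivity |].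
  destruct (Hi (fin_enum_complete n i)).
Qed.

(** Up to phases, [x] is [y] with each coordinate shrunk by the ratio [r i] of the moduli. *)
Lemma norm_monotone {n} (N : vec n -> R) x y :
  is_norm N -> absolute_norm N -> (forall i, Cmod (x i) <= Cmod (y i)) -> N x <= N y.
Proof.
  intros HN HA H.
  set (r := fun i => Cmod (x i) / Cmod (y i)).
  assert (Hr : forall i, 0 <= r i <= 1 /\ r i * Cmod (y i) = Cmod (x i)).
  { intro i. unfold r. specialize (H i). pose proof (Cmod_ge0 (x i)).
    destruct (Req_dec (Cmod (y i)) 0) as [E | E].
    (* Here [x i] vanishes too, so the ratio is 0 whatever value the inverse of 0 has. *)
    - unfold Rdiv. replace (Cmod (x i)) with 0 by lra. lra.
    - split; [| now field]. split.
      + apply Rmult_le_pos; [lra |]. left. apply Rinv_0_lt_compat. lra.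
      + apply (Rmult_le_reg_r (Cmod (y i))); [lra |]. field_simplify; trivial; lra. }
  rewrite (norm_ext_Cmod N x (fun i => Cmul (RtoC (r i)) (y i))); trivial.
  - apply norm_shrink; trivial. intro i. apply Hr.
  - intro i. destruct (Hr i) as [H1 H2]. rewrite Cmod_mul, Cmod_RtoC; lra.
Qed.

(** * Minkowski's theorem *)

Definition subspace {n} (W : vec n -> Prop) : Prop :=
  W vzero /\ (forall v w, W v -> W w -> W (vadd v w)) /\
  (forall t v, W v -> W (rscale t v)).

(* Encodes "real dimension at most [k]" by the length of chains of subspaces. *)
Fixpoint dim_le {n} (k : nat) (W : vec n -> Prop) : Prop :=
  match k with
  | O => forall v, W v -> v = vzero
  | S k => forall W' v, subspace W' -> (forall w, W' w -> W w) -> W v -> ~ W' v -> dim_le k W'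
  end.

Lemma dim_le_sub {n} k (W W' : vec n -> Prop) :
  (forall v, W' v -> W v) -> dim_le k W -> dim_le k W'.
Proof.
  destruct k; simpl; intros H HW; [auto |].
  intros U v HU HUW' Hv. apply HW; auto.
Qed.

(** Let [U] be a proper subspace of [W] missing [v]. If [f] vanishes on [U], then [U] lies in the
    kernel. Otherwise correcting [v] by a multiple of some [w] in [U] gives a kernel vector [z]
    outside [U], so [U] meets the kernel in a proper subspace of it and the induction hypothesis
    applies to [U]. *)
Lemma dim_le_kernel {n} (f : vec n -> R) k (W : vec n -> Prop) :
  (forall v w, f (vadd v w) = f v + f w) -> (forall t v, f (rscale t v) = t * f v) ->
  subspace W -> dim_le k (fun v => W v /\ f v = 0) -> dim_le (S k) W.
Proof.
  intros fD fZ. revert W. induction k as [| k IH]; intros W HW Hk U v HU HUW Hv HnU.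
  all: destruct (classic (forall w, U w -> f w = 0)) as [H0 | H0];
    [apply (dim_le_sub _ _ _ (fun w Hw => conj (HUW w Hw) (H0 w Hw)) Hk) |].
  all: apply not_all_ex_not in H0; destruct H0 as [w Hw];
    apply imply_to_and in Hw; destruct Hw as [Hw Hfw].
  all: set (z := vadd v (rscale (- (f v / f w)) w)).
  all: assert (Hz : W z /\ f z = 0) by
    (split; [apply HW; [assumption | apply HW; auto]
            | unfold z; rewrite fD, fZ; field; assumption]).
  all: assert (HnUz : ~ U z) by
    (intro Uz; apply HnU; replace v with (vadd z (rscale (f v / f w) w)) by (unfold z; vec_ring);
     apply HU; [assumption | now apply HU]).
  - exfalso. apply HnUz. rewrite (Hk z Hz). apply HU.
  - apply IH; [assumption |]. apply (Hk _ z); [| | assumption | tauto].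
    + split; [| split].
      * split; [apply HU |]. replace (@vzero n) with (rscale 0 (@vzero n)) by vec_ring.
        rewrite fZ; ring.
      * intros a b [Ua Ea] [Ub Eb]. split; [now apply HU | rewrite fD; lra].
      * intros t a [Ua Ea]. split; [now apply HU | rewrite fZ, Ea; ring].
    + intros a [Ua Ea]. split; [now apply HUW | assumption].
Qed.

Lemma dim_le_separating {n} (L : list (vec n -> R)) (W : vec n -> Prop) :
  (forall f, In f L -> (forall v w, f (vadd v w) = f v + f w) /\
                       (forall t v, f (rscale t v) = t * f v)) ->
  subspace W -> (forall v, W v -> (forall f, In f L -> f v = 0) -> v = vzero) ->
  dim_le (length L) W.
Proof.
  revert W. induction L as [| f L IH]; intros W HL HW H; simpl length.
  - intros v Hv. apply H; [assumption | intros f []].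
  - destruct (HL f (or_introl eq_refl)) as [fD fZ].
    apply (dim_le_kernel f); trivial. apply IH.
    + intros g Hg. apply HL. now right.
    + split; [| split].
      * split; [apply HW |]. replace (@vzero n) with (rscale 0 (@vzero n)) by vec_ring.
        rewrite fZ; ring.
      * intros a b [Ua Ea] [Ub Eb]. split; [now apply HW | rewrite fD; lra].
      * intros t a [Ua Ea]. split; [now apply HW | rewrite fZ, Ea; ring].
    + intros v [Wv fv] Hv. apply H; [assumption |].
      intros g [<- | Hg]; auto.
Qed.

Lemma subspace_dim_finite {n} (W : vec n -> Prop) : subspace W -> exists k, dim_le k W.
Proof.
  intro HW.
  (* The real and imaginary parts of the coordinates separate points. *)
  set (L := map (fun i (v : vec n) => fst (v i)) (fin_enum n)
            ++ map (fun i (v : vec n) => snd (v i)) (fin_enum n)).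
  exists (length L). apply dim_le_separating; trivial.
  - intros f Hf. apply in_app_or in Hf.
    destruct Hf as [Hf | Hf]; apply in_map_iff in Hf; destruct Hf as [i [<- _]];
      unfold vadd, vscale; simpl; split; intros; ring.
  - intros v _ H. apply functional_extensionality; intro i.
    apply injective_projections; simpl.
    + apply (H (fun v => fst (v i))). apply in_or_app. left.
      apply in_map_iff. exists i. split; [reflexivity | apply fin_enum_complete].
    + apply (H (fun v => snd (v i))). apply in_or_app. right.
      apply in_map_iff. exists i. split; [reflexivity | apply fin_enum_complete].
Qed.

(* The directions of the smallest face of the unit ball containing [x]. *)
Definition face_dir {n} (N : vec n -> R) (x v : vec n) : Prop :=
  exists e, 0 < e /\ N (vadd x (rscale e v)) <= 1 /\ N (vadd x (rscale (- e) v)) <= 1.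

Lemma face_dir_smaller {n} (N : vec n -> R) x v d e :
  is_norm N -> N x <= 1 -> 0 <= d <= e -> N (vadd x (rscale e v)) <= 1 ->
  N (vadd x (rscale d v)) <= 1.
Proof.
  intros HN Hx Hd He. destruct (Req_dec e 0) as [E | E].
  { replace d with e by lra. assumption. }
  replace (vadd x (rscale d v))
    with (vadd (rscale (d / e) (vadd x (rscale e v))) (rscale (1 - d / e) x)).
  - assert (0 <= d / e <= 1).
    { split; [apply Rmult_le_pos; [lra | left; apply Rinv_0_lt_compat; lra] |].
      apply (Rmult_le_reg_r e); [lra |]. field_simplify; lra. }
    apply ball_convex; trivial; lra.
  - apply functional_extensionality; intro i. unfold vadd, vscale.
    apply injective_projections; simpl; field; assumption.
Qed.

Lemma face_dir_subspace {n} (N : vec n -> R) x :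
  is_norm N -> N x <= 1 -> subspace (face_dir N x).
Proof.
  intros HN Hx.
  assert (opp : forall e (v : vec n), rscale (- e) v = rscale e (rscale (-1) v)) by vec_ring.
  split; [| split].
  - exists 1. replace (vadd x (rscale 1 vzero)) with x by vec_ring.
    replace (vadd x (rscale (-(1)) vzero)) with x by vec_ring. lra.
  - intros v w (e & He & H1 & H2) (f & Hf & H3 & H4).
    rewrite opp in H2, H4.
    (* With [m] the minimum, the midpoint of [x + m v] and [x + m w] is [x + (m / 2) (v + w)]. *)
    exists (Rmin e f / 2). pose proof (Rmin_l e f); pose proof (Rmin_r e f).
    assert (0 < Rmin e f) by (now apply Rmin_pos).
    apply (face_dir_smaller N x _ (Rmin e f)) in H1, H2, H3, H4; trivial; try lra.
    split; [lra | split].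
    + replace (vadd x (rscale (Rmin e f / 2) (vadd v w)))
        with (vadd (rscale (/ 2) (vadd x (rscale (Rmin e f) v)))
                   (rscale (/ 2) (vadd x (rscale (Rmin e f) w)))).
      * apply ball_convex; trivial; lra.
      * apply functional_extensionality; intro i. unfold vadd, vscale.
        apply injective_projections; simpl; field.
    + replace (vadd x (rscale (- (Rmin e f / 2)) (vadd v w)))
        with (vadd (rscale (/ 2) (vadd x (rscale (Rmin e f) (rscale (-1) v))))
                   (rscale (/ 2) (vadd x (rscale (Rmin e f) (rscale (-1) w))))).
      * apply ball_convex; trivial; lra.
      * apply functional_extensionality; intro i. unfold vadd, vscale.
        apply injective_projections; simpl; field.
  - intros t v (e & He & H1 & H2).
    assert (S : forall s, Rabs s <= e -> N (vadd x (rscale s v)) <= 1).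
    { intros s Hs. unfold Rabs in Hs. destruct (Rcase_abs s).
      - replace (rscale s v) with (rscale (- s) (rscale (-1) v)) by vec_ring.
        rewrite opp in H2. apply (face_dir_smaller N x _ (- s) e); trivial; lra.
      - apply (face_dir_smaller N x _ s e); trivial; lra. }
    assert (Ht : 0 < 1 + Rabs t) by (pose proof (Rabs_pos t); lra).
    (* Dividing by [1 + Rabs t] avoids a case distinction at [t = 0] and keeps the step along [v]
       within [e]. *)
    assert (Hb : Rabs (e / (1 + Rabs t) * t) <= e).
    { rewrite Rabs_mult, (Rabs_right (e / _)).
      - apply (Rmult_le_reg_r (1 + Rabs t)); [assumption |]. field_simplify; [nra | lra].
      - apply Rle_ge, Rmult_le_pos; [lra |]. left. now apply Rinv_0_lt_compat. }
    exists (e / (1 + Rabs t)). split; [| split].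
    + apply Rmult_lt_0_compat; [lra | now apply Rinv_0_lt_compat].
    + replace (rscale (e / (1 + Rabs t)) (rscale t v))
        with (rscale (e / (1 + Rabs t) * t) v) by vec_ring.
      now apply S.
    + replace (rscale (- (e / (1 + Rabs t))) (rscale t v))
        with (rscale (- (e / (1 + Rabs t) * t)) v) by vec_ring.
      apply S. now rewrite Rabs_Ropp.
Qed.

Lemma ball_line_exit {n} (N : vec n -> R) x v :
  is_norm N -> N x <= 1 -> v <> vzero ->
  exists T, 0 <= T /\ N (vadd x (rscale T v)) <= 1 /\
    forall t, T < t -> 1 < N (vadd x (rscale t v)).
Proof.
  intros HN Hx Hv.
  assert (Nv : 0 < N v).
  { destruct (norm_ge0 N v HN) as [H | H]; [assumption |].
    destruct Hv. now apply HN. }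
  set (E := fun t => 0 <= t /\ N (vadd x (rscale t v)) <= 1).
  assert (E0 : E 0).
  { split; [lra |]. replace (vadd x (rscale 0 v)) with x by vec_ring. assumption. }
  destruct (completeness E) as [T [Tub Tlub]].
  - exists (2 / N v). intros t [Ht HE].
    apply (Rmult_le_reg_r (N v)); [assumption |].
    field_simplify; [| lra]. rewrite <- norm_rscale by assumption.
    replace (rscale t v) with (vadd (vadd x (rscale t v)) (rscale (-1) x)) by vec_ring.
    eapply Rle_trans; [apply HN |]. rewrite norm_opp by assumption. lra.
  - now exists 0.
  - assert (HT : 0 <= T) by (now apply Tub).
    exists T. split; [assumption | split].
    + apply Rnot_lt_le. intro H.
      (* The norm changes along the line at rate at most [N v], so if the point at [T] were outside
         the ball, no admissible [t] would exceed [T - d], against the choice of [T] as supremum. *)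
      set (d := (N (vadd x (rscale T v)) - 1) / N v).
      assert (Hd : 0 < d) by (apply Rmult_lt_0_compat; [lra | now apply Rinv_0_lt_compat]).
      assert (T <= T - d); [| lra].
      apply Tlub. intros t [Ht HE].
      assert (t <= T) by (apply Tub; split; assumption).
      apply (Rmult_le_reg_r (N v)); [assumption |].
      assert (Q : N (vadd x (rscale T v)) <= N (vadd x (rscale t v)) + (T - t) * N v).
      { rewrite <- norm_rscale by (trivial; lra).
        replace (vadd x (rscale T v)) with (vadd (vadd x (rscale t v)) (rscale (T - t) v))
          by vec_ring. apply HN. }
      unfold d. field_simplify; lra.
    + intros t Ht. apply Rnot_le_lt. intro H.
      assert (t <= T) by (apply Tub; split; [lra | assumption]). lra.
Qed.

Lemma lincomb_app {n} (l m : list (C * vec n)) :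
  lincomb (l ++ m) = vadd (lincomb l) (lincomb m).
Proof.
  induction l as [| p l IH]; simpl; [vec_ring |].
  rewrite IH. vec_ring.
Qed.

Lemma in_co_convex {n} (A : vec n -> Prop) x y s t :
  0 <= s -> 0 <= t -> s + t = 1 -> in_co A x -> in_co A y ->
  in_co A (vadd (rscale s x) (rscale t y)).
Proof.
  intros Hs Ht E (l & Hl & El & ->) (m & Hm & Em & ->).
  set (sc := fun r (p : R * vec n) => (r * fst p, snd p)).
  assert (F : forall r k, 0 <= r -> Forall (fun p => 0 <= fst p /\ A (snd p)) k ->
    Forall (fun p => 0 <= fst p /\ A (snd p)) (map (sc r) k)).
  { intros r k Hr. induction 1 as [| p k [Hp Ap] _ IH]; simpl; constructor; trivial.
    simpl. split; [now apply Rmult_le_pos | assumption]. }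
  (* The initial value [c] is kept general because folding over a concatenation starts the first
     list from the sum of the second. *)
  assert (S : forall r (k : list (R * vec n)) c,
    fold_right (fun p s => fst p + s) c (map (sc r) k) =
    r * fold_right (fun p s => fst p + s) 0 k + c).
  { intros r k c. induction k as [| p k IH]; simpl; [ring |]. rewrite IH. ring. }
  assert (L : forall r k, lincomb (map (fun p => (RtoC (fst p), snd p)) (map (sc r) k)) =
    rscale r (lincomb (map (fun p => (RtoC (fst p), snd p)) k))).
  { intros r k. induction k as [| p k IH]; simpl; [vec_ring |]. rewrite IH. vec_ring. }
  exists (map (sc s) l ++ map (sc t) m). split; [| split].
  - apply Forall_app. split; apply F; assumption.
  - rewrite fold_right_app, !S, El, Em. lra.
  - rewrite map_app, lincomb_app, !L. reflexivity.
Qed.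

Lemma in_co_singleton {n} (A : vec n -> Prop) x : A x -> in_co A x.
Proof.
  intro Hx. exists ((1, x) :: nil). split; [| split].
  - constructor; [simpl; split; [lra | assumption] | constructor].
  - simpl. ring.
  - simpl. vec_ring.
Qed.

(** Moving along [v] until leaving the ball reaches a point whose face has strictly fewer
    directions: [v] itself is lost and no new direction appears. *)
Lemma face_dir_exit {n} (N : vec n -> R) x v :
  is_norm N -> N x <= 1 -> face_dir N x v -> v <> vzero ->
  exists T, 0 <= T /\ N (vadd x (rscale T v)) <= 1 /\
    (forall w, face_dir N (vadd x (rscale T v)) w -> face_dir N x w) /\
    ~ face_dir N (vadd x (rscale T v)) v.
Proof.
  intros HN Hx (e & He & _ & Hm) Hv.
  destruct (ball_line_exit N x v HN Hx Hv) as (T & HT & HT1 & HT2).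
  exists T. split; [assumption | split; [assumption | split]].
  - intros w (f & Hf & H1 & H2).
    assert (Hl : 0 < e / (T + e)) by (apply Rmult_lt_0_compat; [lra | apply Rinv_0_lt_compat; lra]).
    assert (Hl' : 1 - e / (T + e) = T / (T + e)) by (field; lra).
    assert (0 <= T / (T + e))
      by (apply Rmult_le_pos; [lra | left; apply Rinv_0_lt_compat; lra]).
    (* Averaging [x + T v + g w] with [x - e v] cancels the [v] terms and leaves a multiple of [w]
       added to [x]. *)
    assert (K : forall g, N (vadd (vadd x (rscale T v)) (rscale g w)) <= 1 ->
      N (vadd x (rscale (e / (T + e) * g) w)) <= 1).
    { intros g Hg.
      replace (vadd x (rscale (e / (T + e) * g) w))
        with (vadd (rscale (e / (T + e)) (vadd (vadd x (rscale T v)) (rscale g w)))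
                   (rscale (T / (T + e)) (vadd x (rscale (- e) v)))).
      - apply ball_convex; trivial; lra.
      - apply functional_extensionality; intro i. unfold vadd, vscale.
        apply injective_projections; simpl; field; lra. }
    exists (e / (T + e) * f). split; [now apply Rmult_lt_0_compat | split].
    + now apply K.
    + replace (- (e / (T + e) * f)) with (e / (T + e) * - f) by ring. now apply K.
  - intros (f & Hf & H1 & _). specialize (HT2 (T + f)).
    replace (vadd x (rscale (T + f) v)) with (vadd (vadd x (rscale T v)) (rscale f v)) in HT2
      by vec_ring. lra.
Qed.

(** Induction on the dimension of the face of [x]. Without a nonzero direction [x] is extreme;
    otherwise it lies between the exit points along [v] and [-v], whose faces have smaller
    dimension. *)
Lemma minkowski_face {n} (N : vec n -> R) k x :
  is_norm N -> N x <= 1 -> dim_le k (face_dir N x) -> in_co (ext_point N) x.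
Proof.
  intro HN. revert x. induction k as [| k IH]; intros x Hx Hk.
  all: destruct (classic (forall v, face_dir N x v -> v = vzero)) as [H0 | H0];
    [apply in_co_singleton; split; [exact Hx |]; intros y z Hy Hz E;
     (* The direction [y - x] is admissible with step 1, since adding it to [x] gives [y] and
        subtracting it gives [z]. *)
     assert (Hv : vadd y (rscale (-1) x) = vzero);
     [ apply H0; exists 1; split; [lra |];
       assert (Ez : z = vadd (vscale (RtoC 2) x) (rscale (-1) y)) by (rewrite <- E; vec_ring);
       replace (vadd x (rscale 1 (vadd y (rscale (-1) x)))) with y by vec_ring;
       replace (vadd x (rscale (- (1)) (vadd y (rscale (-1) x)))) with z
         by (rewrite Ez; vec_ring); split; assumption
     | assert (Ey : y = x) by
         (replace x with (vadd x vzero) by vec_ring; rewrite <- Hv; vec_ring);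
       split; [now symmetry |];
       replace z with (vadd (vscale (RtoC 2) x) (rscale (-1) y)) by (rewrite <- E; vec_ring);
       rewrite Ey; vec_ring ] |].
  - now destruct H0.
  - apply not_all_ex_not in H0. destruct H0 as [v Hv].
    apply imply_to_and in Hv. destruct Hv as [Dv Hv].
    pose proof (face_dir_subspace N x HN Hx) as Dx.
    assert (Dv' : face_dir N x (rscale (-1) v)) by (now apply Dx).
    assert (Hv' : rscale (-1) v <> vzero).
    { intro E. apply Hv. replace v with (rscale (-1) (rscale (-1) v)) by vec_ring.
      rewrite E. vec_ring. }
    destruct (face_dir_exit N x v HN Hx Dv Hv) as (T & HT & B1 & S1 & E1).
    destruct (face_dir_exit N x _ HN Hx Dv' Hv') as (U & HU & B2 & S2 & E2).
    assert (C1 : in_co (ext_point N) (vadd x (rscale T v))).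
    { apply IH; trivial. apply (Hk _ v); trivial. now apply face_dir_subspace. }
    assert (C2 : in_co (ext_point N) (vadd x (rscale U (rscale (-1) v)))).
    { apply IH; trivial. apply (Hk _ (rscale (-1) v)); trivial. now apply face_dir_subspace. }
    destruct (Req_dec (T + U) 0) as [Z | Z].
    + replace x with (vadd x (rscale T v)); [assumption |].
      replace T with 0 by lra. vec_ring.
    (* The weights are proportional to the opposite distances, so the displacements [T v] and [-U v]
       cancel. *)
    + replace x with (vadd (rscale (U / (T + U)) (vadd x (rscale T v)))
                           (rscale (T / (T + U)) (vadd x (rscale U (rscale (-1) v))))).
      * assert (0 < / (T + U)) by (apply Rinv_0_lt_compat; lra).
        apply in_co_convex; trivial; try (apply Rmult_le_pos; lra). field; assumption.
      * apply functional_extensionality; intro i. unfold vadd, vscale.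
        apply injective_projections; simpl; field; assumption.
Qed.

Theorem minkowski_ball {n} (N : vec n -> R) x :
  is_norm N -> N x <= 1 -> in_co (ext_point N) x.
Proof.
  intros HN Hx. destruct (subspace_dim_finite _ (face_dir_subspace N x HN Hx)) as [k Hk].
  now apply (minkowski_face N k).
Qed.

(** * Supporting functionals *)

(** Positive homogeneity is asked as an inequality only; applying it to [/ s] as well gives the
    equality in [sublinear_rscale]. *)
Definition sublinear {n} (p : vec n -> R) : Prop :=
  (forall x y, p (vadd x y) <= p x + p y) /\ (forall s x, 0 < s -> p (rscale s x) <= s * p x).

Lemma sublinear_vzero {n} (p : vec n -> R) : sublinear p -> p vzero = 0.
Proof.
  intros [pD pZ]. pose proof (pD vzero vzero) as H1.
  pose proof (pZ (/ 2) vzero ltac:(lra)) as H2.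
  replace (vadd vzero vzero) with (@vzero n) in H1 by vec_ring.
  replace (rscale (/ 2) vzero) with (@vzero n) in H2 by vec_ring.
  lra.
Qed.

Lemma sublinear_rscale {n} (p : vec n -> R) s x :
  sublinear p -> 0 <= s -> p (rscale s x) = s * p x.
Proof.
  intros Hp [Hs | <-].
  - apply Rle_antisym; [now apply Hp |].
    apply (Rmult_le_reg_l (/ s)); [now apply Rinv_0_lt_compat |].
    rewrite <- Rmult_assoc, Rinv_l, Rmult_1_l by lra.
    replace x with (rscale (/ s) (rscale s x)) at 1.
    + apply Hp. now apply Rinv_0_lt_compat.
    + apply functional_extensionality; intro i. unfold vscale.
      apply injective_projections; simpl; field; lra.
  - replace (rscale 0 x) with (@vzero n) by vec_ring.
    rewrite sublinear_vzero by assumption. ring.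
Qed.

(* The witness is [q x = inf {p (x + t f) - t c | t >= 0, f in K}]. *)
Lemma sublinear_lower {n} (p : vec n -> R) (K : vec n -> Prop) c :
  sublinear p -> convex_set K -> (exists f, K f) -> (forall f, K f -> c <= p f) ->
  exists q, sublinear q /\ (forall x, q x <= p x) /\ (forall f, K f -> q (rscale (-1) f) <= - c).
Proof.
  intros Hp HK [f0 Hf0] Hc.
  (* [completeness] yields suprema, so the set collects the negated values and [q] is minus its
     supremum. *)
  set (E := fun x r => exists t f, 0 <= t /\ K f /\ r = t * c - p (vadd x (rscale t f))).
  assert (Eb : forall x, bound (E x)).
  { intro x. exists (p (rscale (-1) x)). intros r (t & f & Ht & Hf & ->).
    pose proof (proj1 Hp (vadd x (rscale t f)) (rscale (-1) x)) as H.
    replace (vadd (vadd x (rscale t f)) (rscale (-1) x)) with (rscale t f) in H by vec_ring.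
    rewrite (sublinear_rscale p t f) in H by assumption.
    specialize (Hc f Hf). nra. }
  assert (En : forall x, exists r, E x r).
  { intro x. exists (0 * c - p (vadd x (rscale 0 f0))). exists 0, f0.
    split; [lra | now split]. }
  set (q := fun x => - proj1_sig (completeness (E x) (Eb x) (En x))).
  assert (qle : forall x t f, 0 <= t -> K f -> q x <= p (vadd x (rscale t f)) - t * c).
  { intros x t f Ht Hf. unfold q. destruct completeness as [m Hm]; simpl. destruct Hm as [Hm _].
    assert (t * c - p (vadd x (rscale t f)) <= m); [| lra].
    apply Hm. exists t, f. auto. }
  assert (qge : forall x m, (forall t f, 0 <= t -> K f -> m <= p (vadd x (rscale t f)) - t * c) ->
    m <= q x).
  { intros x m H. unfold q. destruct completeness as [b Hb]; simpl. destruct Hb as [_ Hb].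
    assert (b <= - m); [| lra].
    apply Hb. intros r (t & f & Ht & Hf & ->). specialize (H t f Ht Hf). lra. }
  exists q. split; [split | split].
  - intros x y.
    assert (H : forall t f s g, 0 <= t -> K f -> 0 <= s -> K g ->
      q (vadd x y) <= (p (vadd x (rscale t f)) - t * c) + (p (vadd y (rscale s g)) - s * c)).
    { intros t f s g Ht Hf Hs Hg.
      (* Subadditivity rests on convexity of [K]: the combination [t f + s g] is [t + s] times a
         point of [K]. *)
      assert (Hh : exists h, K h /\ vadd (rscale t f) (rscale s g) = rscale (t + s) h).
      { destruct (Req_dec (t + s) 0) as [Z | Z].
        - exists f. split; [assumption |]. replace t with 0 by lra. replace s with 0 by lra.
          vec_ring.
        - exists (vadd (rscale (t / (t + s)) f) (rscale (1 - t / (t + s)) g)). split.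
          + apply HK; trivial. assert (0 < / (t + s)) by (apply Rinv_0_lt_compat; lra).
            split; [apply Rmult_le_pos; lra |].
            apply (Rmult_le_reg_r (t + s)); [lra |]. field_simplify; lra.
          + apply functional_extensionality; intro i. unfold vadd, vscale.
            apply injective_projections; simpl; field; assumption. }
      destruct Hh as (h & Hh & Eh).
      pose proof (qle (vadd x y) (t + s) h ltac:(lra) Hh) as Q.
      rewrite <- Eh in Q.
      replace (vadd (vadd x y) (vadd (rscale t f) (rscale s g)))
        with (vadd (vadd x (rscale t f)) (vadd y (rscale s g))) in Q by vec_ring.
      pose proof (proj1 Hp (vadd x (rscale t f)) (vadd y (rscale s g))). lra. }
    assert (q (vadd x y) - q y <= q x); [| lra].
    apply qge. intros t f Ht Hf.
    assert (q (vadd x y) - (p (vadd x (rscale t f)) - t * c) <= q y); [| lra].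
    apply qge. intros s g Hs Hg. specialize (H t f s g Ht Hf Hs Hg). lra.
  - intros s x Hs. apply (Rmult_le_reg_l (/ s)); [now apply Rinv_0_lt_compat |].
    rewrite <- (Rmult_assoc _ s), Rinv_l, Rmult_1_l by lra.
    apply qge. intros t f Ht Hf.
    apply (Rmult_le_reg_l s); [assumption |].
    rewrite <- Rmult_assoc, Rinv_r, Rmult_1_l by lra.
    eapply Rle_trans; [apply (qle _ (s * t) f); [now apply Rmult_le_pos; lra | assumption] |].
    replace (vadd (rscale s x) (rscale (s * t) f)) with (rscale s (vadd x (rscale t f)))
      by vec_ring.
    rewrite (sublinear_rscale p) by (trivial; lra). lra.
  - intro x. pose proof (qle x 0 f0 ltac:(lra) Hf0) as H.
    replace (vadd x (rscale 0 f0)) with x in H by vec_ring. lra.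
  - intros f Hf. pose proof (qle (rscale (-1) f) 1 f ltac:(lra) Hf) as H.
    replace (vadd (rscale (-1) f) (rscale 1 f)) with (@vzero n) in H by vec_ring.
    rewrite sublinear_vzero in H by assumption. lra.
Qed.

(** Lowering [q] with [K] the single point [v] and [c = q v] gives [r (-v) <= - q v], hence the
    bound at [v]. Bounds obtained earlier survive because lowering only decreases values. *)
Lemma sublinear_lower_list {n} (L : list (vec n)) (p : vec n -> R) :
  sublinear p ->
  exists q, sublinear q /\ (forall x, q x <= p x) /\
    (forall v, In v L -> q v + q (rscale (-1) v) <= 0).
Proof.
  intro Hp. induction L as [| v L (q & Hq & qp & HL)].
  - exists p. repeat split; try apply Hp; [intro; lra | intros v []].
  - destruct (sublinear_lower q (fun w => w = v) (q v)) as (r & Hr & rq & Hv); trivial.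
    + intros x y t -> -> _. vec_ring.
    + now exists v.
    + intros f ->. lra.
    + exists r. split; [assumption | split].
      * intro x. specialize (rq x). specialize (qp x). lra.
      * intros w [<- | Hw].
        -- specialize (rq v). specialize (Hv v eq_refl). lra.
        -- pose proof (rq w). pose proof (rq (rscale (-1) w)). specialize (HL w Hw). lra.
Qed.

(** The vectors [e_i] and [i e_i] form a finite real basis, so finitely many lowerings suffice. The
    bound [u x + u (-x) <= 0] passes to real multiples and sums, so [u] is odd, and an odd sublinear
    function is linear. *)
Theorem hahn_banach {n} (p : vec n -> R) :
  sublinear p ->
  exists u : vec n -> R, (forall x, u x <= p x) /\
    (forall x y, u (vadd x y) = u x + u y) /\ (forall t x, u (rscale t x) = t * u x).
Proof.
  intro Hp.
  destruct (sublinear_lower_list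
    (map unitvec (fin_enum n) ++ map (fun i => vscale (0, 1) (unitvec i)) (fin_enum n)) p Hp)
    as (u & Hu & up & HL).
  assert (odd : forall x, u x + u (rscale (-1) x) <= 0).
  { intro x. apply (coord_ind (fun x => u x + u (rscale (-1) x) <= 0)).
    - replace (rscale (-1) vzero) with (@vzero n) by vec_ring.
      rewrite sublinear_vzero by assumption. lra.
    - intros y z Hy Hz.
      replace (rscale (-1) (vadd y z)) with (vadd (rscale (-1) y) (rscale (-1) z)) by vec_ring.
      pose proof (proj1 Hu y z). pose proof (proj1 Hu (rscale (-1) y) (rscale (-1) z)). lra.
    - intro i.
      assert (sc : forall t v, u v + u (rscale (-1) v) <= 0 ->
        u (rscale t v) + u (rscale (-1) (rscale t v)) <= 0).
      { intros t v Hv. destruct (Rle_dec 0 t) as [Ht | Ht].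
        - replace (rscale (-1) (rscale t v)) with (rscale t (rscale (-1) v)) by vec_ring.
          rewrite !(sublinear_rscale u t) by trivial. nra.
        - replace (rscale (-1) (rscale t v)) with (rscale (- t) v) by vec_ring.
          replace (rscale t v) with (rscale (- t) (rscale (-1) v)) by vec_ring.
          rewrite !(sublinear_rscale u (- t)) by (trivial; lra). nra. }
      replace (vscale (x i) (unitvec i)) with
        (vadd (rscale (fst (x i)) (unitvec i))
              (rscale (snd (x i)) (vscale (0, 1) (unitvec i)))) by vec_ring.
      assert (H1 : u (unitvec i) + u (rscale (-1) (unitvec i)) <= 0).
      { apply HL. apply in_or_app. left. apply in_map, fin_enum_complete. }
      assert (H2 : u (vscale (0, 1) (unitvec i)) + u (rscale (-1) (vscale (0, 1) (unitvec i))) <= 0).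
      { apply HL. apply in_or_app. right.
        apply (in_map (fun i => vscale (0, 1) (unitvec i))), fin_enum_complete. }
      apply (sc (fst (x i))) in H1. apply (sc (snd (x i))) in H2.
      set (y := rscale (fst (x i)) (unitvec i)) in *.
      set (z := rscale (snd (x i)) (vscale (0, 1) (unitvec i))) in *.
      replace (rscale (-1) (vadd y z)) with (vadd (rscale (-1) y) (rscale (-1) z)) by vec_ring.
      pose proof (proj1 Hu y z). pose proof (proj1 Hu (rscale (-1) y) (rscale (-1) z)). lra. }
  assert (opp : forall x, u (rscale (-1) x) = - u x).
  { intro x. apply Rle_antisym; [specialize (odd x); lra |].
    pose proof (proj1 Hu x (rscale (-1) x)) as H.
    replace (vadd x (rscale (-1) x)) with (@vzero n) in H by vec_ring.
    rewrite sublinear_vzero in H by assumption. lra. }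
  exists u. split; [assumption | split].
  - intros x y. apply Rle_antisym; [apply Hu |].
    pose proof (proj1 Hu (rscale (-1) x) (rscale (-1) y)) as H.
    replace (vadd (rscale (-1) x) (rscale (-1) y)) with (rscale (-1) (vadd x y)) in H by vec_ring.
    rewrite !opp in H. lra.
  - intros t x. destruct (Rle_dec 0 t) as [Ht | Ht]; [now apply sublinear_rscale |].
    replace (rscale t x) with (rscale (- t) (rscale (-1) x)) by vec_ring.
    rewrite sublinear_rscale, opp by (trivial; lra). ring.
Qed.

(** Lower [N] along [F] with [c = 1], then take a linear [u] below the result [q]: from
    [u (-f) <= q (-f) <= -1] comes [u f >= 1], while [u f <= N f = 1]. *)
Lemma supporting_functional {n} (N : vec n -> R) (F : vec n -> Prop) :
  is_norm N -> convex_set F -> (exists f, F f) -> (forall f, F f -> in_sphere N f) ->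
  exists u : vec n -> R, (forall x, u x <= N x) /\
    (forall x y, u (vadd x y) = u x + u y) /\ (forall t x, u (rscale t x) = t * u x) /\
    (forall f, F f -> u f = 1).
Proof.
  intros HN HF HF0 HS.
  destruct (sublinear_lower N F 1) as (q & Hq & qN & qF); trivial.
  - split; [apply HN |]. intros s x Hs. rewrite norm_rscale by (trivial; lra). lra.
  - intros f Hf. rewrite (HS f Hf). lra.
  - destruct (hahn_banach q Hq) as (u & uq & uD & uZ).
    exists u. repeat split; trivial.
    + intro x. specialize (uq x). specialize (qN x). lra.
    + intros f Hf. pose proof (uq f). pose proof (qN f). rewrite (HS f Hf) in *.
      pose proof (uq (rscale (-1) f)) as H1. rewrite uZ in H1. specialize (qF f Hf). lra.
Qed.

Lemma max_convex_sphere_through {n} (N : vec n -> R) (e : vec n) :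
  N e = 1 -> exists F, max_convex_sphere N F /\ F e.
Proof.
  intro He.
  (* Membership of [e] is required of nonempty sets only, so that the empty union of an empty chain
     still satisfies [P]. *)
  set (P := fun A : vec n -> Prop =>
    convex_set A /\ (forall x, A x -> in_sphere N x) /\ ((exists x, A x) -> A e)).
  destruct (@classical_sets.Zorn_bigcup (vec n) P) as (F & (Fc & Fs & Fe) & Fmax).
  - intros U HU Utot. split; [| split].
    + intros x y t [A UA Ax] [B UB By] Ht.
      destruct (Utot A B UA UB) as [AB | BA].
      * exists B; [assumption |]. apply (HU B UB); auto.
      * exists A; [assumption |]. apply (HU A UA); auto.
    + intros x [A UA Ax]. now apply (HU A UA).
    + intros [x [A UA Ax]]. exists A; [assumption |]. apply (HU A UA). now exists x.
  (* Without [e] the maximal [F] would be empty, and the singleton of [e] would be strictly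
     larger. *)
  - assert (Fe' : F e).
    { destruct (classic (F e)) as [H | H]; [assumption |]. exfalso.
      apply (Fmax (fun x => x = e)).
      - split; [intros x Hx; destruct H; apply Fe; now exists x |].
        intro S. apply H, S. reflexivity.
      - split; [| split].
        + intros x y t -> -> _. vec_ring.
        + intros x ->. exact He.
        + reflexivity. }
    exists F. split; [| assumption]. split; [assumption | split; [assumption |]].
    intros G Gc Gs FG x Gx. apply NNPP. intro H. apply (Fmax G).
    + split; [exact FG |]. intro S. apply H, S, Gx.
    + split; [assumption | split; [assumption |]]. intros _. now apply FG.
Qed.

(** * Extreme points of CL-spaces *)

(** Extremality is stated for midpoints. A combination with weight [s] is the midpoint of the
    endpoint of larger weight and another point of the segment. *)
Lemma ext_point_convex {n} (N : vec n -> R) x y z s :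
  is_norm N -> ext_point N x -> N y <= 1 -> N z <= 1 -> 0 < s < 1 ->
  x = vadd (rscale s y) (rscale (1 - s) z) -> x = y.
Proof.
  intros HN [_ Hx] Hy Hz Hs E.
  destruct (Rle_dec s (1 / 2)) as [H | H].
  - destruct (Hx (vadd (rscale (2 * s) y) (rscale (1 - 2 * s) z)) z) as [_ Ez]; trivial.
    + apply ball_convex; trivial; lra.
    + rewrite E. vec_ring.
    + assert (Ey : y = vadd (rscale (/ s) x) (rscale (- ((1 - s) / s)) z)).
      { rewrite E. apply functional_extensionality; intro i. unfold vadd, vscale.
        apply injective_projections; simpl; field; lra. }
      rewrite Ey, <- Ez. apply functional_extensionality; intro i. unfold vadd, vscale.
      apply injective_projections; simpl; field; lra.
  - apply (Hx y (vadd (rscale (2 * s - 1) y) (rscale (2 - 2 * s) z))); trivial.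
    + apply ball_convex; trivial; lra.
    + rewrite E. vec_ring.
Qed.

Lemma norm_lincomb {n} (N : vec n -> R) (l : list (C * vec n)) :
  is_norm N -> Forall (fun p => N (snd p) <= 1) l ->
  N (lincomb l) <= fold_right (fun p s => Cmod (fst p) + s) 0 l.
Proof.
  intros HN. induction 1 as [| p l Hp _ IH]; simpl.
  - rewrite norm_vzero by assumption. lra.
  - destruct HN as (_ & HZ & HD). eapply Rle_trans; [apply HD |]. rewrite HZ.
    pose proof (Cmod_ge0 (fst p)). nra.
Qed.

(** At the first nonzero coefficient [c], [x] is a convex combination, with weight [Cmod c], of
    [(c / Cmod c) f] and the rescaled remainder; extremality makes it equal to the former. A list
    without nonzero coefficients would give [x = 0]. *)
Lemma ext_point_in_aco {n} (N : vec n -> R) (F : vec n -> Prop) x :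
  is_norm N -> (forall f, F f -> N f <= 1) -> x <> vzero -> ext_point N x -> in_aco F x ->
  exists c, Cmod c = 1 /\ F (vscale c x).
Proof.
  intros HN HF Hx0 Hx (l & Hl & El & Ex).
  revert El Ex. induction Hl as [| [c f] l Hf Hl IH]; simpl; intros El Ex; [contradiction |].
  simpl in Hf.
  assert (Hr : N (lincomb l) <= fold_right (fun p s => Cmod (fst p) + s) 0 l).
  { apply norm_lincomb; trivial. eapply Forall_impl; [| exact Hl]. simpl. auto. }
  pose proof (norm_ge0 N (lincomb l) HN).
  destruct (Cmod_ge0 c) as [Hc | Hc].
  2:{ apply IH; [lra |]. rewrite Ex, (Cmod_eq0 c) by auto. vec_ring. }
  assert (E : x = vscale (Cmul (RtoC (/ Cmod c)) c) f).
  { destruct (Rlt_dec (Cmod c) 1) as [H1 | H1].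
    - apply (ext_point_convex N x _ (rscale (/ (1 - Cmod c)) (lincomb l)) (Cmod c)); trivial; try lra.
      + destruct HN as (_ & HZ & _).
        rewrite HZ, Cmod_mul, Cmod_RtoC by (left; now apply Rinv_0_lt_compat).
        rewrite Rinv_l by lra. rewrite Rmult_1_l. auto.
      + assert (0 < / (1 - Cmod c)) by (apply Rinv_0_lt_compat; lra).
        rewrite norm_rscale by (trivial; lra).
        apply (Rmult_le_reg_l (1 - Cmod c)); [lra |].
        rewrite <- Rmult_assoc, Rinv_r by lra. lra.
      + rewrite Ex. apply functional_extensionality; intro i. unfold vadd, vscale.
        apply injective_projections; simpl; field; lra.
    (* No weight is left, so the remainder has norm 0. *)
    - assert (Cmod c = 1) as H2 by lra.
      assert (Z : lincomb l = vzero) by (apply HN; lra).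
      rewrite H2, Rinv_1, Ex, Z. vec_ring. }
  pose proof (Cmod_sqr c) as Sq.
  (* The conjugate phase of [c], which undoes the rotation. *)
  exists (fst c / Cmod c, - snd c / Cmod c). split.
  - apply Cmod_eq; [lra |]. simpl. field_simplify_eq; lra.
  - replace (vscale (fst c / Cmod c, - snd c / Cmod c) x) with f; [assumption |].
    rewrite E. apply functional_extensionality; intro i. unfold vscale.
    apply injective_projections; simpl; field_simplify_eq; try lra.
    + rewrite Sq; ring.
    + rewrite Sq; ring.
Qed.

Lemma ext_point_vmul {n} (N : vec n -> R) d x :
  absolute_norm N -> (forall i, Cmod (d i) = 1) -> ext_point N x -> ext_point N (vmul d x).
Proof.
  intros HA Hd [Bx Hx].
  (* The conjugate diagonal is the inverse isometry and pulls a decomposition of [vmul d x] back to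
     one of [x]. *)
  set (d' := fun i => (fst (d i), - snd (d i))).
  assert (Hd' : forall i, Cmod (d' i) = 1).
  { intro i. pose proof (Cmod_sqr (d i)) as E. rewrite Hd in E.
    apply Cmod_eq; [lra |]. simpl. simpl in E. lra. }
  assert (K : forall y, vmul d' (vmul d y) = y /\ vmul d (vmul d' y) = y).
  { intro y. assert (E : forall i, fst (d i) * fst (d i) + snd (d i) * snd (d i) = 1).
    { intro i. pose proof (Cmod_sqr (d i)) as E. rewrite Hd in E. lra. }
    split; apply functional_extensionality; intro i; specialize (E i);
      apply injective_projections; simpl.
    1, 3: transitivity ((fst (d i) * fst (d i) + snd (d i) * snd (d i)) * fst (y i));
      [ring | rewrite E; ring].
    all: transitivity ((fst (d i) * fst (d i) + snd (d i) * snd (d i)) * snd (y i));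
      [ring | rewrite E; ring]. }
  split.
  - unfold in_ball. now rewrite norm_vmul.
  - intros y z Hy Hz E.
    destruct (Hx (vmul d' y) (vmul d' z)) as [Ey Ez].
    + unfold in_ball. now rewrite norm_vmul.
    + unfold in_ball. now rewrite norm_vmul.
    + rewrite <- vmul_vadd, E, vmul_vscale. now rewrite (proj1 (K x)).
    + split; [rewrite Ey | rewrite Ez]; apply K.
Qed.

(** The origin is the midpoint of [e_j] and [-e_j]; the index [j] guarantees that the space is
    nonzero. *)
Lemma ext_point_neq0 {n} (N : vec n -> R) (j : Fin.t n) x :
  is_norm N -> absolute_norm N -> ext_point N x -> x <> vzero.
Proof.
  intros HN [_ HA] [_ Hx] ->.
  destruct (Hx (unitvec j) (rscale (-1) (unitvec j))) as [E _].
  - unfold in_ball. rewrite HA. lra.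
  - unfold in_ball. rewrite norm_opp, HA by assumption. lra.
  - vec_ring.
  - specialize (HA j). rewrite <- E, norm_vzero in HA by assumption. lra.
Qed.

(* A norming functional of a maximal convex set through [e_j], its coefficients rotated to
   be nonnegative: it attains its norm at every nonnegative extreme point at once. *)
Lemma CL_positive_functional {n} (N : vec n -> R) (j : Fin.t n) :
  is_norm N -> absolute_norm N -> CL_space N ->
  exists g : vec n -> R,
    (forall x y, g (vadd x y) = g x + g y) /\ (forall t x, g (rscale t x) = t * g x) /\
    (forall x, g x <= N x) /\
    (forall i, 0 <= g (unitvec i)) /\ 0 < g (unitvec j) /\
    (forall x, ext_point N x -> nonneg_vec x -> 1 <= g x).
Proof.
  intros HN HA HCL.
  destruct (max_convex_sphere_through N (unitvec j)) as (F & HF & Fj); [apply HA |].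
  destruct HF as (Fc & Fs & Fm).
  destruct (supporting_functional N F) as (u & uN & uD & uZ & uF); trivial.
  { now exists (unitvec j). }
  set (al := fun k => u (unitvec k)).
  set (be := fun k => u (vscale (0, 1) (unitvec k))).
  assert (uE : forall c k, u (vscale c (unitvec k)) = fst c * al k + snd c * be k).
  { intros c k. unfold al, be. rewrite <- !uZ, <- uD. f_equal. vec_ring. }
  (* On coordinate [k], [u] is the real part of [c] times the conjugate of [al k + i be k].
     Premultiplying by the phase [d k] of that number turns this into [w k] times the real part of
     [c]; where [w k = 0] the phase is set to 1. *)
  set (w := fun k => Cmod (al k, be k)).
  set (d := fun k => if Req_dec_T (w k) 0 then C1 else (al k / w k, be k / w k)).
  assert (Hw : forall k, w k ^ 2 = al k ^ 2 + be k ^ 2) by (intro k; apply Cmod_sqr).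
  assert (Hw0 : forall k, 0 <= w k) by (intro k; apply Cmod_ge0).
  assert (Hd : forall k, Cmod (d k) = 1 /\ fst (d k) * al k + snd (d k) * be k = w k /\
    fst (d k) * be k - snd (d k) * al k = 0).
  { intro k. specialize (Hw k). specialize (Hw0 k). unfold d.
    destruct (Req_dec_T (w k) 0) as [E | E]; simpl.
    - rewrite E in *. split; [apply Cmod_C1 |]. nra.
    - split; [| split].
      + apply Cmod_eq; [lra |]. simpl. field_simplify_eq; lra.
      + field_simplify_eq; lra.
      + field; assumption. }
  set (g := fun x => u (vmul d x)).
  assert (gE : forall c k, g (vscale c (unitvec k)) = fst c * w k).
  { intros c k. unfold g.
    replace (vmul d (vscale c (unitvec k))) with (vscale (Cmul c (d k)) (unitvec k)).
    - rewrite uE. destruct (Hd k) as (_ & H1 & H2). rewrite <- H1. simpl.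
      transitivity (fst c * (fst (d k) * al k + snd (d k) * be k)
        + snd c * (fst (d k) * be k - snd (d k) * al k)); [ring | rewrite H2; ring].
    - apply functional_extensionality; intro i. unfold vmul, vscale, unitvec.
      destruct (Fin.eq_dec i k) as [-> |]; apply injective_projections; simpl; ring. }
  assert (gD : forall x y, g (vadd x y) = g x + g y).
  { intros x y. unfold g. now rewrite vmul_vadd, uD. }
  assert (gZ : forall t x, g (rscale t x) = t * g x).
  { intros t x. unfold g. now rewrite vmul_vscale, uZ. }
  assert (gU : forall k, g (unitvec k) = w k).
  { intro k. replace (unitvec k) with (vscale C1 (unitvec k)) by vec_ring.
    rewrite gE. simpl. ring. }
  exists g. split; [assumption | split; [assumption | split; [| split; [| split]]]].
  - intro x. eapply Rle_trans; [apply uN |]. rewrite norm_vmul; [lra | assumption |].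
    intro i. apply Hd.
  - intro i. now rewrite gU.
  (* Since [e_j] belongs to [F], [al j = 1]. *)
  - rewrite gU. specialize (Hw j). pose proof (uF _ Fj). fold (al j) in H.
    specialize (Hw0 j). nra.
  - intros x Hx Px.
    assert (Hy : ext_point N (vmul d x)).
    { apply ext_point_vmul; trivial. intro i. apply Hd. }
    destruct (ext_point_in_aco N F (vmul d x)) as (c & Hc & Fc'); trivial.
    + intros f Ff. rewrite (Fs f Ff). lra.
    + now apply (ext_point_neq0 N j).
    + apply HCL; [split; [assumption | split; assumption] |]. apply Hy.
    (* Now 1 is [g (c x)], which is at most [g x] because [c] has real part at most 1 and the
       coordinates of [x] and the [w i] are nonnegative. *)
    + rewrite <- (uF _ Fc'), <- vmul_vscale.
      change (g (vscale c x) <= g x).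
      apply (coord_ind (fun x => g (vscale c x) <= g x)).
      * right. f_equal. vec_ring.
      * intros y z Hy' Hz'.
        replace (vscale c (vadd y z)) with (vadd (vscale c y) (vscale c z)) by vec_ring.
        rewrite !gD. lra.
      * intro i.
        replace (vscale c (vscale (x i) (unitvec i)))
          with (vscale (Cmul c (x i)) (unitvec i)) by vec_ring.
        rewrite !gE. simpl. destruct (Px i) as [P1 P2]. rewrite P2.
        pose proof (Cmod_sqr c) as E. rewrite Hc in E.
        specialize (Hw0 i).
        assert (fst c <= 1) by nra.
        assert (0 <= fst (x i) * w i) by (now apply Rmult_le_pos). nra.
Qed.

(* Equality in the triangle inequalities forces [y] and [i y] to be both real multiples
   of [a]. *)
Lemma Cmod_four_rotations a y :
  Cmod (Cadd a y) + Cmod (Cadd a (Cmul (-1, 0) y)) +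
  Cmod (Cadd a (Cmul (0, 1) y)) + Cmod (Cadd a (Cmul (0, -1) y)) <= 4 * Cmod a -> y = C0.
Proof.
  intro H.
  pose proof (Cmod_opposite_sum a) as T.
  assert (Q : forall v, Cmod (Cadd a v) + Cmod (Cadd a (Cmul (-1, 0) v)) <= 2 * Cmod a ->
    (fst a * fst v + snd a * snd v) ^ 2 = Cmod a ^ 2 * Cmod v ^ 2 /\
    (Cmod a = 0 -> Cmod v = 0)).
  { intros v Hv. specialize (T v).
    pose proof (Cmod_sqr (Cadd a v)) as E1.
    pose proof (Cmod_sqr (Cadd a (Cmul (-1, 0) v))) as E2.
    pose proof (Cmod_sqr a) as E3. pose proof (Cmod_sqr v) as E4.
    pose proof (Cmod_ge0 (Cadd a v)). pose proof (Cmod_ge0 (Cadd a (Cmul (-1, 0) v))).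
    pose proof (Cmod_ge0 v).
    set (A := Cmod (Cadd a v)) in *. set (B := Cmod (Cadd a (Cmul (-1, 0) v))) in *.
    simpl in E1, E2.
    set (m := Cmod a) in *. set (r := Cmod v) in *.
    (* The parallelogram and polarization identities. With [A + B = 2 m] they give inner product
       [m (A - m)] and [r ^ 2 = (A - m) ^ 2], which is equality in Cauchy-Schwarz. *)
    assert (S1 : A ^ 2 + B ^ 2 = 2 * m ^ 2 + 2 * r ^ 2) by (simpl in *; lra).
    assert (S2 : A ^ 2 - B ^ 2 = 4 * (fst a * fst v + snd a * snd v)) by (simpl in *; lra).
    assert (S3 : B = 2 * m - A) by lra.
    split.
    - replace (fst a * fst v + snd a * snd v) with ((A ^ 2 - B ^ 2) / 4) by lra.
      rewrite S3 in *.
      replace ((A ^ 2 - (2 * m - A) ^ 2) / 4) with (m * (A - m)) by field.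
      rewrite Rpow_mult_distr. f_equal. lra.
    - intro Z. nra. }
  pose proof (T y). pose proof (T (Cmul (0, 1) y)) as T2.
  replace (Cmul (-1, 0) (Cmul (0, 1) y)) with (Cmul (0, -1) y) in T2
    by (apply injective_projections; simpl; ring).
  destruct (Q y ltac:(lra)) as [Q1 Q2].
  destruct (Q (Cmul (0, 1) y)) as [Q3 _].
  { replace (Cmul (-1, 0) (Cmul (0, 1) y)) with (Cmul (0, -1) y)
      by (apply injective_projections; simpl; ring). lra. }
  rewrite Cmod_mul, (Cmod_eq 1 (0, 1)) in Q3 by (simpl; lra).
  apply Cmod_eq0. destruct (Req_dec (Cmod a) 0) as [Z | Z]; [now apply Q2 |].
  rewrite Rmult_1_l, Cmod_sqr, Cmod_sqr in Q3. rewrite Cmod_sqr, Cmod_sqr in Q1.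
  pose proof (Cmod_sqr a) as Ea. pose proof (Cmod_sqr y) as Ey. simpl in Q1, Q3.
  (* The squared inner products of [a] with [y] and with [i y] add up to this product, yet each of
     them equals it. *)
  assert (P : Cmod a ^ 2 * Cmod y ^ 2 = 0) by (rewrite Ea, Ey; nra).
  apply Rmult_integral in P. destruct P as [P | P]; nra.
Qed.

(** * From convex combinations to complex extreme points *)

Lemma positive_functional_ge0 {n} (g : vec n -> R) x :
  (forall x y, g (vadd x y) = g x + g y) -> (forall t x, g (rscale t x) = t * g x) ->
  (forall i, 0 <= g (unitvec i)) -> nonneg_vec x -> 0 <= g x.
Proof.
  intros gD gZ gU Hx. apply (coord_ind (fun x => 0 <= g x)).
  - replace (@vzero n) with (rscale 0 (@vzero n)) by vec_ring. rewrite gZ. lra.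
  - intros y z Hy Hz. rewrite gD. lra.
  - intro i. destruct (Hx i) as [H1 H2].
    replace (x i) with (RtoC (fst (x i))) by (apply injective_projections; simpl; lra).
    rewrite gZ. now apply Rmult_le_pos.
Qed.

Lemma co_nonneg_ext_complex_ext {n} (N : vec n -> R) a :
  is_norm N -> absolute_norm N -> CL_space N ->
  in_co (fun x => ext_point N x /\ nonneg_vec x) (vabs a) -> complex_ext_point N a.
Proof.
  intros HN HA HCL (l & Hl & El & Ea). split.
  - unfold in_ball. rewrite (proj1 HA), Ea, <- El.
    eapply Rle_trans; [apply norm_lincomb; [assumption |] |].
    + apply Forall_map. eapply Forall_impl; [| exact Hl]. simpl. intros p Hp. apply Hp.
    + clear El Ea. induction Hl as [| p l Hp _ IH]; simpl; [lra |].
      rewrite Cmod_RtoC by apply Hp. lra.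
  - intros y Hy. apply functional_extensionality; intro j.
    destruct (CL_positive_functional N j HN HA HCL) as (g & gD & gZ & gN & gU & gj & gext).
    assert (ga : 1 <= g (vabs a)).
    { rewrite Ea, <- El. clear El Ea. induction Hl as [| p l [Hp [Hp1 Hp2]] _ IH]; simpl.
      - right. replace (@vzero n) with (rscale 0 (@vzero n)) by vec_ring. rewrite gZ. ring.
      - rewrite gD, gZ. specialize (gext _ Hp1 Hp2). nra. }
    set (z := fun c => vabs (vadd a (vscale c y))).
    assert (gz : forall c, (exists t, 0 <= t <= 2 * PI /\ c = Cexpi t) -> g (z c) <= 1).
    { intros c (t & Ht & ->). eapply Rle_trans; [apply gN |]. unfold z.
      rewrite <- (proj1 HA). now apply Hy. }
    pose proof PI_RGT_0.
    assert (z1 : g (z (1, 0)) <= 1).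
    { apply gz. exists 0. split; [lra |]. unfold Cexpi. now rewrite cos_0, sin_0. }
    assert (z2 : g (z (-1, 0)) <= 1).
    { apply gz. exists PI. split; [lra |]. unfold Cexpi. now rewrite cos_PI, sin_PI. }
    assert (z3 : g (z (0, 1)) <= 1).
    { apply gz. exists (PI / 2). split; [lra |]. unfold Cexpi. now rewrite cos_PI2, sin_PI2. }
    assert (z4 : g (z (0, -1)) <= 1).
    { apply gz. exists (3 * (PI / 2)). split; [lra |]. unfold Cexpi.
      now rewrite cos_3PI2, sin_3PI2. }
    (* The excess of the four rotated moduli over four times the modulus of [a]: nonnegative in each
       coordinate by the triangle inequality on opposite pairs, while [g b <= 4 - 4]. *)
    set (b := vadd (vadd (vadd (z (1, 0)) (z (-1, 0))) (vadd (z (0, 1)) (z (0, -1))))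
                   (rscale (-4) (vabs a))).
    assert (gb : g b <= 0) by (unfold b; rewrite !gD, gZ; lra).
    assert (one : forall i, Cmul (1, 0) (y i) = y i)
      by (intro i; apply injective_projections; simpl; ring).
    assert (Hb : nonneg_vec b).
    { intro i. unfold b, z, vadd, vscale, vabs. simpl. rewrite one.
      pose proof (Cmod_opposite_sum (a i) (y i)).
      pose proof (Cmod_opposite_sum (a i) (Cmul (0, 1) (y i))) as T2.
      replace (Cmul (-1, 0) (Cmul (0, 1) (y i))) with (Cmul (0, -1) (y i)) in T2
        by (apply injective_projections; simpl; ring).
      split; lra. }
    (* Splitting off coordinate [j]: as [g b'] is nonnegative and [g (unitvec j)] positive, the
       excess in coordinate [j] cannot be positive. *)
    set (b' := fun i => if Fin.eq_dec i j then C0 else b i).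
    assert (Eb : b = vadd (rscale (fst (b j)) (unitvec j)) b').
    { apply functional_extensionality; intro i. unfold vadd, vscale, b', unitvec.
      destruct (Fin.eq_dec i j) as [-> | Hij].
      - destruct (Hb j) as [_ Hb2]. apply injective_projections; simpl; lra.
      - apply injective_projections; simpl; ring. }
    assert (gb' : 0 <= g b').
    { apply positive_functional_ge0; trivial. intro i. unfold b'.
      destruct (Fin.eq_dec i j); [simpl; lra | apply Hb]. }
    rewrite Eb, gD, gZ in gb.
    assert (bj : fst (b j) <= 0) by nra.
    apply (Cmod_four_rotations (a j)).
    unfold b, z, vadd, vscale, vabs in bj. simpl in bj. rewrite one in bj. lra.
Qed.

(** * From complex extreme points to convex combinations *)

Lemma vabs_vmul {n} (x : vec n) : exists d, (forall i, Cmod (d i) = 1) /\ vmul d x = vabs x.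
Proof.
  (* Conjugate phases, with 1 chosen at vanishing coordinates to keep the entries unimodular. *)
  exists (fun i => if Req_dec_T (Cmod (x i)) 0 then C1
                   else (fst (x i) / Cmod (x i), - snd (x i) / Cmod (x i))).
  split; [intro i | apply functional_extensionality; intro i; unfold vmul, vabs];
    destruct (Req_dec_T (Cmod (x i)) 0) as [E | E].
  - apply Cmod_C1.
  - pose proof (Cmod_sqr (x i)). apply Cmod_eq; [lra |]. simpl. field_simplify_eq; lra.
  - rewrite E, (Cmod_eq0 _ E). apply injective_projections; simpl; ring.
  - pose proof (Cmod_sqr (x i)).
    apply injective_projections; simpl; field_simplify_eq; lra.
Qed.

Lemma complex_ext_co_nonneg_ext {n} (N : vec n -> R) a :
  is_norm N -> absolute_norm N -> complex_ext_point N a ->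
  in_co (fun x => ext_point N x /\ nonneg_vec x) (vabs a).
Proof.
  intros HN HA [Ba Ca].
  destruct (minkowski_ball N a HN Ba) as (l & Hl & El & Ea).
  set (l' := map (fun p => (fst p, vabs (snd p))) l).
  assert (Hl' : Forall (fun p => 0 <= fst p /\ (ext_point N (snd p) /\ nonneg_vec (snd p))) l').
  { apply Forall_map. eapply Forall_impl; [| exact Hl]. simpl. intros p [Hp1 Hp2].
    split; [assumption | split].
    - destruct (vabs_vmul (snd p)) as (d & Hd & <-). now apply ext_point_vmul.
    - intro i. unfold vabs. simpl. split; [apply Cmod_ge0 | reflexivity]. }
  assert (El' : fold_right (fun p s => fst p + s) 0 l' = 1).
  { rewrite <- El. unfold l'. clear. induction l as [| p l IH]; simpl; [reflexivity |].
    now rewrite IH. }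
  set (y := lincomb (map (fun p => (RtoC (fst p), snd p)) l')).
  assert (By : N y <= 1).
  { rewrite <- El'. unfold y. eapply Rle_trans; [apply norm_lincomb; [assumption |] |].
    - apply Forall_map. eapply Forall_impl; [| exact Hl']. simpl. intros p Hp. apply Hp.
    - clear - Hl'. induction Hl' as [| p l' Hp _ IH]; simpl; [lra |].
      rewrite Cmod_RtoC by apply Hp. lra. }
  assert (Hy : forall i, snd (y i) = 0 /\ Cmod (a i) <= fst (y i)).
  { intro i. rewrite Ea. unfold y, l'. clear - Hl.
    induction Hl as [| p l [Hp _] _ IH]; simpl.
    - split; [reflexivity |]. unfold vzero. rewrite Cmod_C0. simpl. lra.
    - destruct IH as [IH1 IH2]. unfold vadd, vscale. split.
      + rewrite IH1. ring.
      + eapply Rle_trans; [apply Cmod_triangle |].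
        rewrite Cmod_mul, Cmod_RtoC by assumption. lra. }
  exists l'. split; [assumption | split; [assumption |]].
  fold y.
  (* The gap between [y] and the moduli of [a]: each coordinate of [a + e^(i theta) b] has modulus
     at most that of [y]. *)
  set (b := fun i => RtoC (fst (y i) - Cmod (a i))).
  assert (Zb : b = vzero).
  { apply Ca. intros t _. eapply Rle_trans; [| exact By].
    apply norm_monotone; trivial. intro i. unfold vadd, vscale.
    destruct (Hy i) as [H1 H2].
    eapply Rle_trans; [apply Cmod_triangle |]. rewrite Cmod_mul, Cmod_Cexpi.
    unfold b. rewrite Cmod_RtoC by lra.
    rewrite (Cmod_eq (fst (y i)) (y i)); [lra | |].
    - pose proof (Cmod_ge0 (a i)). lra.
    - rewrite H1. ring. }
  apply functional_extensionality; intro i. destruct (Hy i) as [H1 _].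
  apply (f_equal (fun v => fst (v i))) in Zb. unfold b, vzero in Zb. simpl in Zb.
  apply injective_projections; unfold vabs; simpl; lra.
Qed.

Theorem theorem5p1 (n : nat) (N : vec n -> R) :
  is_norm N -> absolute_norm N -> CL_space N ->
  forall a : vec n,
    complex_ext_point N a <->
    in_co (fun x => ext_point N x /\ nonneg_vec x) (vabs a).
Proof.
  intros HN HA HCL a. split.
  - now apply complex_ext_co_nonneg_ext.
  - now apply co_nonneg_ext_complex_ext.
Qed.
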